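(* Let $M$ be a matroid of rank $r$ on $n$ elements and let $C$ be a circuit of $M$. Then $$\beta_C\le\frac{\binom{r+1}{|C|}}{\binom{n}{|C|}}=\frac{(r+1)!\cdot(n-|C|)!}{n!\cdot(r+1-|C|)!}.$$
   Context: Matroid bingo: let $M$ be a matroid on a finite set $E$ with $|E|=n$ and circuit set $\mathcal{C}$. The elements of $E$ are called out one at a time in a uniformly random order $\sigma(1),\sigma(2),\dots,\sigma(n)$ (a uniformly random permutation of $E$). A circuit $C$ wins in round $t$ if $C\subseteq\{\sigma(1),\dots,\sigma(t)\}$ and no circuit of $M$ is contained in $\{\sigma(1),\dots,\sigma(t-1)\}$; thus the winner is the first circuit to be completed (the circuit axioms guarantee that there is no tie). $\beta_C$ denotes the probability that $C$ wins (in some round). *)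

(* Defs.v *)
From HB Require Import structures.
From mathcomp Require Import all_boot all_order all_algebra.
Set Implicit Arguments.
Unset Strict Implicit.
Unset Printing Implicit Defensive.
Import Order.TTheory GRing.Theory Num.Theory.
Local Open Scope ring_scope.

Record matroid (E : finType) := Matroid {
  indep : {set {set E}};
  indep0 : set0 \in indep;
  indepS : forall A B : {set E}, A \subset B -> B \in indep -> A \in indep;
  indep_augment : forall A B : {set E},
    A \in indep -> B \in indep -> (#|A| < #|B|)%N ->
    exists2 x, x \in B :\: A & x |: A \in indep
}.

Section Bingo.
Variables (E : finType) (M : matroid E).
Implicit Types (s : {ffun 'I_#|E| -> E}) (C D : {set E}) (t : nat).

Definition circuits : {set {set E}} :=
  [set C | minset [pred A : {set E} | A \notin indep M] C].

Definition rank : nat := \max_(A in indep M) #|A|.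

(* Injectivity suffices for bijectivity, as 'I_#|E| and E have the same
   cardinality. The element called out in round t (counted from 1) is the
   value of s at index t.-1. *)
Definition orders : {set {ffun 'I_#|E| -> E}} :=
  [set s : {ffun 'I_#|E| -> E} | injectiveb s].

Definition called s t : {set E} := [set s i | i : 'I_#|E| & (i < t)%N].

Definition wins_in_round s C t : bool :=
  (C \subset called s t) &&
  [forall D in circuits, ~~ (D \subset called s t.-1)].

Definition wins s C : bool :=
  [exists i : 'I_#|E|, wins_in_round s C i.+1].

Definition beta C : rat :=
  #|[set s in orders | wins s C]|%:R / #|orders|%:R.

End Bingo.

(* Main.v *)
(* When C wins in round t, the first t - 1 elements called contain no circuit,
   so they are independent and t <= r + 1. Hence C is contained in the set of
   the first r + 1 elements called, which is a uniformly random (r + 1)-subset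
   of E. *)
Require Import Defs.
From HB Require Import structures.
From mathcomp Require Import all_boot all_order all_algebra all_fingroup ring.
Set Implicit Arguments.
Unset Strict Implicit.
Unset Printing Implicit Defensive.
Import Order.TTheory GRing.Theory Num.Theory.
Local Open Scope ring_scope.

(** List [T] with [A] first and its complement after, and again with [B] first. Matching equal
    positions in the two lists is a permutation, and it sends the initial block [A] onto the initial
    block [B] because the two have the same length. *)
Lemma perm_imset_eq_card (T : finType) (A B : {set T}) :
  #|A| = #|B| -> exists p : {perm T}, p @: A = B.
Proof.
move=> eqAB.
pose l (X : {set T}) := enum X ++ enum (~: X).
have l_all X x : x \in l X by rewrite mem_cat !mem_enum inE orbN.
have l_uniq X : uniq (l X).
  rewrite cat_uniq !enum_uniq andbT /=; apply/hasPn => x.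
  by rewrite !mem_enum inE.
have l_size X : size (l X) = #|T| by rewrite size_cat -!cardE cardsC.
pose f x := nth x (l B) (index x (l A)).
have lt_index x : (index x (l A) < size (l B))%N.
  by rewrite l_size -(l_size A) index_mem.
have f_inj : injective f.
  move=> x y; rewrite /f (set_nth_default x y) // => /eqP.
  rewrite nth_uniq // => /eqP eq_ix.
  by rewrite -(nth_index x (l_all A x)) eq_ix nth_index.
exists (perm f_inj); apply/eqP; rewrite eqEcard card_imset ?eqAB ?leqnn //;
  last exact: perm_inj.
rewrite andbT; apply/subsetP => _ /imsetP[x Ax ->].
rewrite permE /f /l index_cat mem_enum Ax nth_cat -cardE -eqAB cardE.
rewrite index_mem mem_enum Ax -mem_enum mem_nth // -cardE -eqAB cardE.
by rewrite index_mem mem_enum.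
Qed.

Section Orders.
Variables (E : finType) (M : matroid E).
Implicit Types (s : {ffun 'I_#|E| -> E}) (A C D : {set E}).

Lemma subset_called s m1 m2 : (m1 <= m2)%N -> called s m1 \subset called s m2.
Proof.
move=> le_m; apply: imsetS; apply/subsetP => i.
by rewrite !inE => /leq_trans; apply.
Qed.

Lemma card_called s m :
  s \in orders E -> (m <= #|E|)%N -> #|called s m| = m.
Proof.
rewrite inE => /injectiveP s_inj le_mE.
rewrite /called card_imset //.
have -> : [set i : 'I_#|E| | (i < m)%N] = widen_ord le_mE @: [set: 'I_m].
  apply/setP => i; rewrite inE; apply/idP/imsetP => [lt_im | [j _ ->]].
    by exists (Ordinal lt_im) => //; apply: val_inj.
  exact: (ltn_ord j).
rewrite card_imset ?cardsT ?card_ord // => i j [eq_ij].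
exact: val_inj.
Qed.

Definition orders_calling m C := [set s in orders E | C \subset called s m].

Lemma in_orders_calling m C s :
  (s \in orders_calling m C) = (s \in orders E) && (C \subset called s m).
Proof. by rewrite in_set. Qed.

(** Relabelling the elements by [p] permutes the orders and carries the set of the first [m] called
    elements to its image. This symmetry is what makes that set uniformly distributed. *)
Lemma card_orders_calling_imset m C (p : {perm E}) :
  #|orders_calling m (p @: C)| = #|orders_calling m C|.
Proof.
pose g s : {ffun 'I_#|E| -> E} := [ffun i => p (s i)].
have g_inj : injective g.
  move=> s1 s2 eq_g; apply/ffunP => i; apply: (@perm_inj _ p).
  by move/ffunP/(_ i): eq_g; rewrite !ffunE.
(* Surjectivity of [g]: every order can be written as a [g]-value, on which membership in the image
   of [g] is easy to test. *)
have gK s : g [ffun i => (p^-1)%g (s i)] = s.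
  by apply/ffunP => i; rewrite !ffunE permKV.
have called_g s : called (g s) m = p @: called s m.
  by rewrite /called -imset_comp; apply: eq_imset => i; rewrite /= ffunE.
have orders_g s : (g s \in orders E) = (s \in orders E).
  rewrite !inE; apply/injectiveP/injectiveP => inj i j.
    by move=> eq_s; apply: inj; rewrite !ffunE eq_s.
  by rewrite !ffunE => /perm_inj/inj.
rewrite -[RHS](card_imset _ g_inj); apply: eq_card => s.
rewrite -[s]gK mem_imset // !in_orders_calling orders_g called_g.
congr (_ && _); apply/idP/idP => [|]; last exact: imsetS.
move=> /subsetP sub; apply/subsetP => x Cx.
by have := sub (p x); rewrite !(mem_imset _ _ (@perm_inj _ p)); apply.
Qed.

(** Double counting of the pairs of an order [s] and a set [D] of size [#|C|] inside [called s m].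
    By symmetry each [D] occurs with equally many orders, while each order admits ['C(m, #|C|)]
    sets. The product form keeps the identity in the natural numbers. *)
Lemma card_orders_calling m C : (m <= #|E|)%N ->
  (#|orders_calling m C| * 'C(#|E|, #|C|) = #|orders E| * 'C(m, #|C|))%N.
Proof.
move=> le_mE; pose k := #|C|.
transitivity (\sum_(D : {set E} | #|D| == k) #|orders_calling m D|)%N.
  rewrite (eq_bigr (fun=> #|orders_calling m C|)) => [|D /eqP cardD].
    by rewrite sum_nat_const -card_draws mulnC cardsE.
  by have [p <-] := perm_imset_eq_card cardD; rewrite card_orders_calling_imset.
rewrite (eq_bigr (fun D : {set E} =>
  \sum_(s in orders E) (D \subset called s m : nat))%N) => [|D _].
  rewrite exchange_big /= -sum_nat_const; apply: eq_bigr => s s_ord.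
  rewrite -{2}(card_called s_ord le_mE) -cards_draws -sum1_card.
  rewrite -big_mkcondr /=; apply: eq_bigl => D.
  by rewrite !inE andbC.
rewrite -sum1_card -big_mkcondr /=; apply: eq_bigl => s.
by rewrite inE.
Qed.

Lemma card_le_rank A : A \in indep M -> (#|A| <= rank M)%N.
Proof. by move=> indA; rewrite /rank; exact: leq_bigmax_cond. Qed.

Lemma dependent_contains_circuit A :
  A \notin indep M -> exists2 D, D \in circuits M & D \subset A.
Proof.
move=> /(minset_exists (P := [pred A | A \notin indep M]))[D minD sDA].
by exists D; rewrite ?inE.
Qed.

Lemma circuit_dependent C : C \in circuits M -> C \notin indep M.
Proof. by rewrite inE => /minsetp. Qed.

(** An independent set of size [#|E|] would be all of [E] and so contain the dependent set [C]. The
    bound guarantees that a round [(rank M).+1] exists. *)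
Lemma rank_lt_of_circuit C : C \in circuits M -> (rank M < #|E|)%N.
Proof.
move=> /circuit_dependent depC.
have E_gt0 : (0 < #|E|)%N.
  rewrite -cardsT (leq_trans _ (subset_leq_card (subsetT C))) // card_gt0.
  by apply: contraNneq depC => ->; apply: indep0.
rewrite -(prednK E_gt0) ltnS; apply/bigmax_leqP => A indA.
rewrite -ltnS (prednK E_gt0) ltnNge -cardsT.
apply: contra depC => le_EA; apply: indepS indA.
by have /eqP-> : A == setT by rewrite eqEcard subsetT.
Qed.

Lemma card_circuit_le C : C \in circuits M -> (#|C| <= (rank M).+1)%N.
Proof.
move=> circC; have depC := circuit_dependent circC.
have [x Cx] : exists x, x \in C.
  by apply/set0Pn; apply: contraNneq depC => ->; apply: indep0.
rewrite (cardsD1 x) Cx ltnS; apply: card_le_rank.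
(* By minimality of [C], if [C] without [x] were dependent it would equal [C], which contains
   [x]. *)
apply: contraLR Cx => depCx; move: circC; rewrite inE => /minsetP[_ minC].
by rewrite -(minC _ depCx (subD1set C x)) setD11.
Qed.

Lemma wins_called s C :
  s \in orders E -> wins M s C -> C \subset called s (rank M).+1.
Proof.
move=> s_ord /existsP[i /andP[sCi /forall_inP no_circ]].
(* The index [i] counts from 0, so the win is in round [i.+1] and exactly [i] elements were called
   before it; it suffices that [i <= rank M]. *)
apply: subset_trans sCi (subset_called _ _); rewrite ltnS.
rewrite -(card_called s_ord (ltnW (ltn_ord i))); apply: card_le_rank.
apply: contraT => /dependent_contains_circuit[D circD sDi].
by have := no_circ D circD; rewrite sDi.
Qed.

End Orders.

Lemma bin_ratioE (R : numFieldType) m n k : (k <= m)%N -> (k <= n)%N ->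
  'C(m, k)%:R / 'C(n, k)%:R = (m`! * (n - k)`!)%:R / (n`! * (m - k)`!)%:R :> R.
Proof.
move=> le_km le_kn.
have nz0 j : (0 < j)%N -> j%:R != 0 :> R by rewrite pnatr_eq0 -lt0n.
apply/eqP; rewrite eqr_div ?nz0 ?muln_gt0 ?bin_gt0 ?fact_gt0 // -!natrM.
by rewrite -(bin_fact le_km) -(bin_fact le_kn); apply/eqP; congr _%:R; ring.
Qed.

Theorem theorem4 (E : finType) (M : matroid E) (n r : nat)
    (card_E : #|E| = n) (rank_M : rank M = r)
    (C : {set E}) (circuit_C : C \in circuits M) :
  beta M C <= 'C(r.+1, #|C|)%:R / 'C(n, #|C|)%:R
  /\ 'C(r.+1, #|C|)%:R / 'C(n, #|C|)%:R
     = ((r.+1)`! * (n - #|C|)`!)%:R / (n`! * (r.+1 - #|C|)`!)%:R :> rat.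
Proof.
have le_CE : (#|C| <= n)%N by rewrite -card_E max_card.
have le_Cr : (#|C| <= r.+1)%N by rewrite -rank_M card_circuit_le.
split; last exact: bin_ratioE.
have lt_rE : (r < #|E|)%N by rewrite -rank_M (rank_lt_of_circuit circuit_C).
have bin_pos : 0 < 'C(n, #|C|)%:R :> rat by rewrite ltr0n bin_gt0.
(* If there were no orders, the quotient would be 0 by the convention for division by zero, so their
   existence need not be proved. *)
rewrite /beta; have [->|ord_gt0] := posnP #|orders E|.
  by rewrite invr0 mulr0 divr_ge0.
rewrite ler_pdivrMr ?ltr0n // mulrAC ler_pdivlMr // -!natrM ler_nat.
(* With denominators cleared, the counting identity at [m = r.+1] gives both sides the factor
   ['C(#|E|, #|C|)]. Cancelling it leaves an inclusion between sets of orders. *)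
rewrite mulnC [leqRHS]mulnC -card_E -card_orders_calling // mulnC leq_mul2r.
apply/orP; right; apply/subset_leq_card/subsetP => s.
rewrite !in_set => /andP[s_ord win]; rewrite s_ord -rank_M.
by apply: wins_called win; rewrite inE.
Qed.
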